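(* Let $X,Y$ be metric spaces, $X\times Y$ with the maximum metric, and let $g,h$ be Hausdorff functions. For any set $E\subseteq X\times Y$: (i) $\overline{\mathcal P}^{gh}(E)\ge\int^*\vec{\mathcal B}^{g}(E_x)\,d\overline{\mathcal P}^{h}(x)$; (ii) $\underline{\mathcal P}^{gh}(E)\ge\int^*\underline{\mathcal B}^{g}(E_x)\,d\underline{\mathcal P}^{h}(x)$; (iii) $\vec{\mathcal P}^{gh}(E)\ge\int^*\vec{\mathcal B}^{g}(E_x)\,d\underline{\mathcal P}^{h}(x)$; (iv) $\vec{\mathcal P}^{gh}(E)\ge\inf_{x\in X}\vec{\mathcal B}^{g}(E_x)\cdot\vec{\mathcal P}^{h}(X)$.
   Context: In a metric space $(X,d)$: $\operatorname{gap}F=\inf\{d(x,y):x,y\in F,x\neq y\}$, $C_\delta(E)=\sup\{|F|:F\subseteq E,\operatorname{gap}F>\delta\}$. A Hausdorff function is a nondecreasing $g:(0,\infty)\to(0,\infty)$; $gh$ is the pointwise product. A scale is a set $\Delta\subseteq(0,\infty)$ with $0$ in its closure. A packing is a family $\pi=\{(x_i,r_i):i\in I\}\subseteq X\times(0,\infty)$ with $d(x_i,x_j)>r_i$ for $i\ne j$; it is a packing of $E$ if all $x_i\in E$, $\Delta$-valued if all $r_i\in\Delta$, $\delta$-fine if all $r_i\le\delta$; $g(\pi)=\sum_ig(r_i)$. Let $\mathcal P^g_{\Delta,0}(E)=\inf_{\delta>0}\sup\{g(\pi):\pi$ a $\Delta$-valued $\delta$-fine packing of $E\}$. Set $\overline{\mathcal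 P}^g_0=\mathcal P^g_{(0,\infty),0}$, $\underline{\mathcal P}^g_0(E)=\inf_\Delta\mathcal P^g_{\Delta,0}(E)$ (infimum over all scales), $\underline{\mathcal B}^g_0(E)=\liminf_{\delta\to0}C_\delta(E)g(\delta)$. For a set function $\tau$ let $\widehat\tau(E)=\inf\{\sum_n\tau(E_n):E\subseteq\bigcup_nE_n\}$ (countable covers) and $\overrightarrow\tau(E)=\inf\{\sup_n\tau(E_n):E_n\uparrow E\}$, where $E_n\uparrow E$ means $(E_n)$ increasing with union $E$. Then $\overline{\mathcal P}^g=\widehat{\overline{\mathcal P}^g_0}$ (the packing measure), $\underline{\mathcal P}^g=\widehat{\underline{\mathcal P}^g_0}$, $\underline{\mathcal B}^g=\widehat{\underline{\mathcal B}^g_0}$ (Hewitt–Stromberg measure), $\vec{\mathcal P}^g=\overrightarrow{\underline{\mathcal P}^g_0}$, $\vec{\mathcal B}^g=\overrightarrow{\underline{\mathcal B}^g_0}$. The set functions $\overline{\mathcal P}^h,\underline{\mathcal P}^h$ are Borel measures when restricted to Borel sets. $E_x=\{y:(x,y)\in E\}$. Upper integral: $\int^*f\,d\mu=\inf\{\int\varphi\,d\mu:\varphi\ge f$ Borel measurable$\}$. *)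

(* Defs.v *)
From HB Require Import structures.
From mathcomp Require Import all_boot all_order all_algebra.
From mathcomp Require Import finmap.
From mathcomp Require Import all_classical all_reals all_analysis. From mathcomp Require Import measurable_realfun.
Set Implicit Arguments. Unset Strict Implicit. Unset Printing Implicit Defensive.
Import Order.TTheory GRing.Theory Num.Theory.
Import numFieldNormedType.Exports.
Local Open Scope classical_set_scope.
Local Open Scope ring_scope.

Section Premeasures.
Context {R : realType} {T : choiceType} (d : T -> T -> R).
Local Open Scope ereal_scope.

(* gap F = inf { d(x,y) : x, y in F, x <> y }  (inf of the empty set = +oo) *)
Definition gap (F : set T) : \bar R :=
  ereal_inf [set (d xy.1 xy.2)%:E
            | xy in [set xy : T * T | [/\ F xy.1, F xy.2 & xy.1 <> xy.2]]].

Definition ecard (F : set T) : \bar R :=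
  if pselect (finite_set F) then (#|` fset_set F|%:R)%:E else +oo.

Definition Cdelta (delta : R) (E : set T) : \bar R :=
  ereal_sup [set ecard F | F in [set F | F `<=` E /\ delta%:E < gap F]].

Definition lowerB0 (g : R -> R) (E : set T) : \bar R :=
  ereal_sup [set ereal_inf [set Cdelta delta E * (g delta)%:E
                             | delta in `]0%R, eps[ ]
            | eps in `]0%R, +oo[ ].

(* a packing: a family of pairs (x_i, r_i), r_i > 0, d(x_i,x_j) > r_i (i<>j);
   represented as the set of its pairs *)
Definition packing (P : set (T * R)) : Prop :=
  (forall p, P p -> (0 < p.2)%R) /\
  (forall p q, P p -> P q -> p <> q -> (p.2 < d p.1 q.1)%R).

Definition packing_of (E : set T) (Delta : set R) (delta : R) (P : set (T * R)) :=
  [/\ packing P, (forall p, P p -> E p.1),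
      (forall p, P p -> Delta p.2) & (forall p, P p -> (p.2 <= delta)%R)].

Definition gpack (g : R -> R) (P : set (T * R)) : \bar R :=
  \esum_(p in P) (g p.2)%:E.

Definition PDelta0 (g : R -> R) (Delta : set R) (E : set T) : \bar R :=
  ereal_inf [set ereal_sup [set gpack g P | P in packing_of E Delta delta]
            | delta in `]0%R, +oo[ ].

Definition scale (Delta : set R) : Prop :=
  Delta `<=` `]0%R, +oo[ /\ closure Delta 0%R.

Definition upperP0 (g : R -> R) (E : set T) : \bar R :=
  PDelta0 g `]0%R, +oo[ E.

Definition lowerP0 (g : R -> R) (E : set T) : \bar R :=
  ereal_inf [set PDelta0 g Delta E | Delta in scale].

End Premeasures.

Section Constructions.
Context {R : realType} {T : Type}.
Local Open Scope ereal_scope.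

Definition hat (tau : set T -> \bar R) (E : set T) : \bar R :=
  ereal_inf [set \sum_(0 <= n <oo) tau (F n)
            | F in [set F : (set T)^nat | E `<=` \bigcup_n F n]].

Definition arrow (tau : set T -> \bar R) (E : set T) : \bar R :=
  ereal_inf [set ereal_sup (range (fun n => tau (F n)))
            | F in [set F : (set T)^nat |
                     (forall n, F n `<=` F n.+1) /\ \bigcup_n F n = E]].
End Constructions.

Section Measures.
Context {R : realType} {T : choiceType} (d : T -> T -> R).

Definition upperP (g : R -> R) := hat (upperP0 d g).
Definition lowerP (g : R -> R) := hat (lowerP0 d g).
Definition lowerB (g : R -> R) := hat (lowerB0 d g).
Definition vecP (g : R -> R) := arrow (lowerP0 d g).
Definition vecB (g : R -> R) := arrow (lowerB0 d g).
End Measures.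

Definition hausdorff_fun {R : realType} (g : R -> R) : Prop :=
  (forall r, (0 < r)%R -> (0 < g r)%R) /\
  (forall r s, (0 < r)%R -> (r <= s)%R -> (g r <= g s)%R).

Definition maxdist {R : realType} {X Y : metricType R} (p q : X * Y) : R :=
  Num.max (mdist p.1 q.1) (mdist p.2 q.2).

Definition pt_alias (T : Type) (x0 : T) := T.
HB.instance Definition _ (T : choiceType) (x0 : T) :=
  Choice.on (pt_alias x0).
HB.instance Definition _ (T : choiceType) (x0 : T) :=
  isPointed.Build (pt_alias x0) x0.

Section UpperIntegral.
Context {R : realType} {T : topologicalType}.
Local Open Scope ereal_scope.

Definition borel_sets (x0 : T) : set (set (pt_alias x0)) := [set A | @open T A].

(* inf { int phi dmu : phi >= f, phi Borel measurable } ; the integral only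
   evaluates mu on Borel sets, i.e. uses the restriction of mu to Borel sets *)
Definition upper_int_pt (x0 : T) (mu : set T -> \bar R) (f : T -> \bar R) : \bar R :=
  ereal_inf [set @integral _ (g_sigma_algebraType (@borel_sets x0)) R mu setT phi
            | phi in [set phi : g_sigma_algebraType (@borel_sets x0) -> \bar R |
                       measurable_fun setT phi /\ (forall x, f x <= phi x)]].

Definition upper_int (mu : set T -> \bar R) (f : T -> \bar R) : \bar R :=
  match pselectT T with
  | inr x0 => upper_int_pt x0 mu f
  | inl _ => 0
  end.
End UpperIntegral.

(* Main.v *)
(* For a fixed scale Delta, replacing each point (x, r) of a packing of A by the
   points ((x, y), r), with y in an r-separated subset of the section E_x, gives
   t * P_Delta(A) <= P_Delta(E & A x Y) as soon as C_r(E_x) g(r) > t for all x in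
   A and all small r.  Both sides, as functions of A, are monotone and
   superadditive on positively separated sets, so their countable-cover
   regularizations mu and nu are Borel measures (Caratheodory's criterion) and
   t mu <= nu on subsets of {f > t}, where f(x) is the infimum of C_r(E_x) g(r)
   over small r.  Packing premeasures do not change under closure, hence
   mu has Borel hulls G_t of {f > t}; the supremum of t 1_{G_t} over rational t is
   a Borel majorant of f with integral at most nu(X).  Letting the bound on r go
   to 0, and then letting E vary along an increasing sequence or a countable
   cover, uses monotone convergence and sigma-subadditivity of upper integrals. *)
Require Import Defs.
From HB Require Import structures.
From mathcomp Require Import all_boot all_order all_algebra.
From mathcomp Require Import finmap.
From mathcomp Require Import all_classical all_reals all_analysis.
From mathcomp Require Import measurable_realfun lra.
Import Order.TTheory GRing.Theory Num.Theory.
Local Open Scope classical_set_scope.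
Local Open Scope ring_scope.

Set Implicit Arguments.
Unset Strict Implicit.
Unset Printing Implicit Defensive.

(** * Countable-cover regularizations as outer measures *)

Section hat_outer_measure.
Context (R : realType) (T : choiceType) (x0 : T) (tau : set T -> \bar R).
Hypothesis tau0 : tau set0 = 0%E.
Hypothesis tau_ge0 : forall A, (0 <= tau A)%E.
Local Open Scope ereal_scope.

(* [mu_ext] is [hat] over a type whose subsets are all measurable. *)
Lemma hat_mu_ext : hat tau =
  @mu_ext _ (g_sigma_algebraType [set: set (pt_alias x0)]) R tau.
Proof.
apply/funext => A; rewrite /hat /mu_ext; congr (ereal_inf (_ @` _)).
apply/seteqP; split => F /=; last by case.
by move=> AF; split => // i; exact: sub_sigma_algebra.
Qed.

Lemma hat0 : hat tau set0 = 0.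
Proof. by rewrite hat_mu_ext mu_ext0. Qed.

Lemma hat_ge0 A : 0 <= hat tau A.
Proof. by apply: le_ereal_inf_tmp => _ [F _ <-]; exact: nneseries_ge0. Qed.

Lemma le_hat : {homo hat tau : A B / A `<=` B >-> A <= B}.
Proof. by move=> A B AB; rewrite hat_mu_ext; exact: le_mu_ext. Qed.

Lemma hat_sigma_subadditive : sigma_subadditive (hat tau).
Proof. by move=> F; rewrite hat_mu_ext; exact: mu_ext_sigma_subadditive. Qed.

Definition hat_outer : {outer_measure set T -> \bar R} :=
  HB.pack (hat tau) (isOuterMeasure.Build R T (hat tau)
    hat0 hat_ge0 le_hat hat_sigma_subadditive).

Lemma hat_le A : hat tau A <= tau A.
Proof.
apply: ereal_inf_lbound; exists (bigcup2 A set0) => /=.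
  by rewrite bigcup2E setU0.
rewrite (nneseries_split _ 1)// eseries0 ?big_nat1 ?adde0//.
by move=> [|[|k]].
Qed.

End hat_outer_measure.

(** * Metric premeasures and Caratheodory's criterion *)

Section metric_premeasure.
Context {R : realType} {T : choiceType} (d : T -> T -> R).
Local Open Scope ereal_scope.

Definition positively_separated (A B : set T) :=
  exists2 e : R, (0 < e)%R & forall a b, A a -> B b -> (e <= d a b)%R.

(** The features shared by [PDelta0] and [lowerP0] that make their [hat] a Borel measure. *)
Record metric_premeasure (tau : set T -> \bar R) : Prop := MetricPremeasure {
  premeasure0 : tau set0 = 0 ;
  premeasure_ge0 : forall A, 0 <= tau A ;
  le_premeasure : {homo tau : A B / A `<=` B >-> A <= B} ;
  premeasure_separated : forall A B, positively_separated A B ->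
    tau A + tau B <= tau (A `|` B) }.

End metric_premeasure.

Section caratheodory_criterion.
Context {R : realType} {X : metricType R} (x0 : X) (tau : set X -> \bar R).
Hypothesis tauP : metric_premeasure (@mdist R X) tau.
Local Open Scope ereal_scope.

Let mu := hat_outer x0 (premeasure0 tauP) (premeasure_ge0 tauP).

(* The shells [D n] of [F] around [C] are separated whenever they are not adjacent,
   so their premeasures are summable and the tail near [C] is negligible. *)
Lemma hat_closed_splits (C F : set X) : closed C ->
  hat tau (F `&` C) + hat tau (F `&` ~` C) <= tau F.
Proof.
move=> clC; have [->|] := eqVneq (tau F) +oo; first by rewrite leey.
rewrite -ltey => tauF.
have tau_ge0 := premeasure_ge0 tauP.
have le_tau := le_premeasure tauP.
pose Fn n := F `&` [set x | forall c, C c -> (n.+1%:R^-1 <= mdist x c)%R].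
have FnF n : Fn n `<=` F by move=> x [].
have Fn_nd n : Fn n `<=` Fn n.+1.
  move=> x [Fx Cx]; split => // c /Cx; apply: le_trans.
  by rewrite lef_pV2 ?posrE// ler_nat.
pose D n := Fn n.+1 `\` Fn n.
(* A point of [D n.+1] is closer than 1/(n+2) to some point of [C], while a point of [Fn n] is at
   least 1/(n+1) away from all of [C]; the triangle inequality leaves a gap. *)
have sepD n : tau (Fn n) + tau (D n.+1) <= tau (Fn n.+2).
  apply: (le_trans (premeasure_separated tauP _)).
    exists (n.+1%:R^-1 - n.+2%:R^-1)%R.
      by rewrite subr_gt0 ltf_pV2 ?posrE// ltr_nat.
    move=> a b [Fa Ca] [[Fb _] /not_andP[//|]].
    move=> /existsNP[c /not_implyP[Cc /negP]]; rewrite -ltNge => bc.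
    rewrite lerBlDr (le_trans (Ca _ Cc))// (le_trans (metric_triangle _ b _))//.
    by rewrite lerD2l ltW.
  by apply: le_tau => x [/Fn_nd/Fn_nd//|[]].
(* Adding the shell [D n.+1] turns the bound for [Fn n] into one for [Fn n.+2], so a sliding pair of
   consecutive sets controls even and odd shells together. *)
have sumD n : \sum_(0 <= k < n) tau (D k.+1) <= tau (Fn n) + tau (Fn n.+1).
  elim: n => [|n ih]; first by rewrite big_geq// adde_ge0.
  rewrite big_nat_recr//= (le_trans (leeD2r _ ih))//.
  by rewrite addeAC [leRHS]addeC leeD2r.
have Doo : \sum_(0 <= k <oo) tau (D k.+1) < +oo.
  apply: (@le_lt_trans _ _ (tau F + tau F)); last by rewrite lte_add_pinfty.
  apply: lime_le; first exact: is_cvg_nneseries.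
  by apply: nearW => n; rewrite (le_trans (sumD n))// leeD// le_tau.
apply/lee_addgt0Pr => e e0.
have : \forall N \near \oo, \sum_(N <= k <oo) tau (D k.+1) < e%:E.
  have := nneseries_tail_cvg Doo (fun k _ => tau_ge0 _).
  move=> /fine_cvgP[finD /cvgrPdist_lt /(_ e e0) De].
  near=> N; have finN : \sum_(N <= k <oo) tau (D k.+1) \is a fin_num.
    by near: N.
  rewrite -(fineK finN) lte_fin (le_lt_trans (ler_norm _))//.
  by rewrite -normrN -[X in `|X|%R]add0r; near: N.
move=> [N _ /(_ N (leqnn N)) /= tailN].
have FC : tau (F `&` C) + tau (Fn N.+1) <= tau F.
  rewrite addeC (le_trans (premeasure_separated tauP _))//.
    exists (N.+2%:R^-1)%R; first by rewrite invr_gt0.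
    by move=> a b [_ +] [_ Cb]; apply.
  by apply: le_tau => x [/FnF|[]].
have FnC : hat tau (F `&` ~` C) <= tau (Fn N.+1) + e%:E.
  (* A point of [F] off the closed set [C] is at positive distance from [C], hence in some [Fn n];
     at the least such [n] it is either in [Fn N.+1] or in a shell of the tail. *)
  have sub : F `&` ~` C `<=` Fn N.+1 `|` \bigcup_(n in ~` `I_N) D n.+1.
    move=> x [Fx Cx].
    have [n Fnx] : exists n, Fn n x.
      have : nbhs x (~` C) by apply: open_nbhs_nbhs; split => //; exact: closed_openC.
      rewrite -nbhs_ballE => -[r /= r0]; rewrite ballEmdist => xrC.
      exists (Num.truncn r^-1); split => // c Cc; rewrite leNgt; apply/negP => xc.
      apply: (xrC c) => //=; rewrite (lt_le_trans xc)// -[leRHS]invrK.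
      by rewrite lef_pV2 ?posrE ?invr_gt0// ltW// truncnS_gt.
    elim: n Fnx => [|n ih] Fnx.
      by left; elim: (N.+1) => [|m]//; exact: Fn_nd.
    have [/ih//|nFnx] := pselect (Fn n x).
    have [nN|Nn] := leqP n N.
      left; move: nN; rewrite -ltnS => /subnK <-.
      by elim: (N.+1 - n.+1)%N => // m; rewrite addSn; exact: Fn_nd.
    right; exists n.-1; first by apply/negP; rewrite -leqNgt -ltnS (ltn_predK Nn).
    by rewrite (ltn_predK Nn).
  apply: (le_trans (le_outer_measure mu _ _ sub)).
  apply: (le_trans (outer_measureU2 _ _ _)).
  apply: leeD; first exact: (hat_le (premeasure0 tauP)).
  apply: (le_trans (outer_measure_sigma_subadditive_tail mu N (fun n => D n.+1))).
  apply: le_trans (ltW tailN); apply: lee_nneseries => *.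
    exact: (outer_measure_ge0 mu).
  exact: (hat_le (premeasure0 tauP)).
apply: (le_trans (leeD (hat_le _ _ _) FnC)) => //.
  exact: premeasure0 tauP.
by rewrite addeA leeD2r.
Unshelve. all: end_near. Qed.

(** Each member of a cover is split by [hat_closed_splits]; the two families of pieces cover the
    parts of the set inside and outside [C]. *)
Lemma hat_closed_caratheodory (C : set X) : closed C ->
  (hat tau).-caratheodory C.
Proof.
move=> clC; apply: (@le_caratheodory_measurable _ _ mu) => A.
apply: le_ereal_inf_tmp => _ [F AF <-].
have hge0 := outer_measure_ge0 mu.
apply: (@le_trans _ _ (\sum_(0 <= n <oo) (mu (F n `&` C) + mu (F n `&` ~` C)))).
  rewrite nneseriesD//.
  have sub B : mu (A `&` B) <= \sum_(0 <= n <oo) mu (F n `&` B).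
    apply: le_trans (outer_measure_sigma_subadditive mu (fun n => F n `&` B)).
    by apply: le_outer_measure; rewrite -setI_bigcupl; exact: setSI.
  by rewrite leeD.
apply: lee_nneseries => [n _ _|n _]; first by rewrite adde_ge0.
exact: hat_closed_splits.
Qed.

Lemma hat_borel_caratheodory (A : set X) :
  <<s @borel_sets X x0 >> A -> (hat tau).-caratheodory A.
Proof.
apply: smallest_sub; last first.
  move=> B oB; rewrite -[B]setCK.
  apply: (@caratheodory_measurable_setC _ _ mu).
  exact/hat_closed_caratheodory/open_closedC.
split.
- exact: (caratheodory_measurable_set0 mu).
- move=> B hB; rewrite setTD.
  exact: (@caratheodory_measurable_setC _ _ mu).
- exact: (@caratheodory_measurable_bigcup _ _ mu).
Qed.

Lemma hat_borel_semi_sigma_additive :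
  semi_sigma_additive
    (hat tau : set (g_sigma_algebraType (@borel_sets X x0)) -> \bar R).
Proof.
move=> A mA tA mUA.
apply: (@caratheodory_measure_sigma_additive R (pt_alias x0) mu A) => //.
  by move=> n; exact: hat_borel_caratheodory (mA n).
exact: hat_borel_caratheodory mUA.
Qed.

(** [upper_int_pt] integrates against the bare function [hat tau]; this packed form makes the lemmas
    on integrals apply to it. *)
Definition hat_borel :
    {measure set (g_sigma_algebraType (@borel_sets X x0)) -> \bar R} :=
  HB.pack (hat tau : set (g_sigma_algebraType (@borel_sets X x0)) -> \bar R)
    (isMeasure.Build _ _ _
      (hat tau : set (g_sigma_algebraType (@borel_sets X x0)) -> \bar R)
      (outer_measure0 mu) (outer_measure_ge0 mu) hat_borel_semi_sigma_additive).

End caratheodory_criterion.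

(** * Upper integrals: monotone convergence and countable subadditivity *)

Section upper_integral.
Context {R : realType} {X : topologicalType} (x0 : X).
Local Open Scope ereal_scope.
Let B := g_sigma_algebraType (@borel_sets X x0).
Variable mu : {measure set B -> \bar R}.

Lemma le_upper_int_pt (f g : X -> \bar R) : (forall x, f x <= g x) ->
  upper_int_pt x0 mu f <= upper_int_pt x0 mu g.
Proof.
move=> fg; apply: ereal_inf_le_tmp => _ [phi [mphi gphi] <-].
by exists phi => //; split => // x; exact: le_trans (gphi x).
Qed.

Lemma upper_int_pt_le (f : X -> \bar R) (c : \bar R) :
  (forall e : R, (0 < e)%R -> exists phi : B -> \bar R,
    [/\ measurable_fun setT phi, forall x, f x <= phi x &
        \int[mu]_x phi x <= c + e%:E]) ->
  upper_int_pt x0 mu f <= c.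
Proof.
move=> fc; apply/lee_addgt0Pr => e /fc[phi [mphi fphi phic]].
by apply: le_trans phic; apply: ereal_inf_lbound; exists phi.
Qed.

Lemma upper_int_pt_majorant (f : X -> \bar R) (c : \bar R) (e : R) :
  (0 < e)%R -> c \is a fin_num -> upper_int_pt x0 mu f <= c ->
  exists phi : B -> \bar R, [/\ measurable_fun setT phi,
    forall x, f x <= phi x & \int[mu]_x phi x <= c + e%:E].
Proof.
move=> e0 cfin fc; have : upper_int_pt x0 mu f < c + e%:E.
  by rewrite (le_lt_trans fc)// lteDl// lte_fin.
by move=> /ereal_inf_lt[_ [phi [mphi fphi] <-] /ltW phic]; exists phi.
Qed.

(** Near-optimal Borel majorants [phi n] of [f n] need not increase, so their lower limit is taken:
    it dominates every [f n] because [f] increases, and Fatou's lemma bounds its integral. *)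
Lemma upper_int_pt_monotone_convergence (f : nat -> X -> \bar R) (c : \bar R) :
  (forall n x, 0 <= f n x) -> (forall n x, f n x <= f n.+1 x) ->
  (forall n, upper_int_pt x0 mu (f n) <= c) -> 0 <= c ->
  upper_int_pt x0 mu (fun x => ereal_sup (range (f ^~ x))) <= c.
Proof.
move=> f0 fnd fc c0; have [->|] := eqVneq c +oo; first by rewrite leey.
rewrite -ltey => coo; have cfin : c \is a fin_num by rewrite ge0_fin_numE.
apply: upper_int_pt_le => e e0.
have /choice[phi phiP] n := upper_int_pt_majorant e0 cfin (fc n).
have mphi n : measurable_fun setT (phi n) by case: (phiP n).
have phi0 n x : 0 <= phi n x.
  by case: (phiP n) => _ /(_ x) + _; exact: le_trans.
have fnd' x : nondecreasing_seq (f ^~ x) by apply/nondecreasing_seqP => n.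
exists (fun x => limn_einf (phi ^~ x)); split.
- by apply: measurableT_comp => //; apply: measurable_fun_limn_esup => n;
    exact: measurableT_comp.
- move=> x; apply: ge_ereal_sup => _ [n _ <-]; rewrite limn_einf_lim.
  apply: lime_ge; first exact: is_cvg_einfs.
  near=> m; apply: le_ereal_inf_tmp => _ [k /= mk <-].
  have [_ /(_ x) + _] := phiP k; apply: le_trans; apply: fnd'.
  by apply: leq_trans mk; near: m; exact: nbhs_infty_ge.
- apply: (le_trans (fatou mu measurableT mphi (fun n x _ => phi0 n x))).
  rewrite limn_einf_lim; apply: lime_le; first exact: is_cvg_einfs.
  apply: nearW => n; apply: ereal_inf_le; exists (\int[mu]_x phi n x).
    by exists n => /=.
  by case: (phiP n).
Unshelve. all: end_near. Qed.

(** Majorants of the [g n] with errors summing to [e] are added up, and their sum is integrated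
    termwise. *)
Lemma upper_int_pt_sigma_subadditive (f : X -> \bar R) (g : nat -> X -> \bar R)
    (c : nat -> \bar R) :
  (forall n x, 0 <= g n x) -> (forall n, 0 <= c n) ->
  (forall x, f x <= \sum_(0 <= n <oo) g n x) ->
  (forall n, upper_int_pt x0 mu (g n) <= c n) ->
  upper_int_pt x0 mu f <= \sum_(0 <= n <oo) c n.
Proof.
move=> g0 c0 fg gc.
have [[i ioo]|/forallNP coo] := pselect (exists i, c i = +oo).
  rewrite (eseries_pinfty _ _ ioo) ?leey// => n _.
  by rewrite -ltNye (lt_le_trans _ (c0 n)).
have cfin n : c n \is a fin_num.
  by rewrite ge0_fin_numE// ltey; apply/eqP; exact: coo.
apply: upper_int_pt_le => e e0.
have e2 n : (0 < e / (2 ^ n.+1)%:R)%R by rewrite divr_gt0// ltr0n expn_gt0.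
have /choice[phi phiP] n := upper_int_pt_majorant (e2 n) (cfin n) (gc n).
have mphi n : measurable_fun setT (phi n) by case: (phiP n).
have phi0 n x : 0 <= phi n x.
  by case: (phiP n) => _ /(_ x) + _; exact: le_trans.
exists (fun x => \sum_(0 <= n <oo) phi n x); split.
- exact: ge0_emeasurable_sum.
- move=> x; apply: (le_trans (fg x)); apply: lee_nneseries => // n _.
  by case: (phiP n).
- rewrite integral_nneseries//; apply: le_trans (epsilon_trick _ c0 (ltW e0)).
  apply: lee_nneseries => [n _ _|n _]; first exact: integral_ge0.
  by case: (phiP n).
Qed.

End upper_integral.

(** * Comparison of an upper integral with a premeasure *)

Section integral_comparison.
Context {R : realType} {X : metricType R} (x0 : X) (tau nu : set X -> \bar R).
Local Open Scope ereal_scope.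
Hypothesis tauP : metric_premeasure (@mdist R X) tau.
Hypothesis tau_closure : forall A, tau (closure A) <= tau A.
Hypothesis nuP : metric_premeasure (@mdist R X) nu.

Let B := g_sigma_algebraType (@borel_sets X x0).
Let mtau := hat_outer x0 (premeasure0 tauP) (premeasure_ge0 tauP).
Let mnu := hat_outer x0 (premeasure0 nuP) (premeasure_ge0 nuP).
Let mu := hat_borel x0 tauP.

Lemma closed_borel_measurable (C : set X) : closed C -> measurable (C : set B).
Proof.
move=> clC; rewrite -[C]setCK; apply: measurableC.
by apply: sub_sigma_algebra; exact: closed_openC.
Qed.

(** By [tau_closure], members of a cover may be replaced by their closures at no cost; intersecting
    such covers of error 1/(n+1) gives the hull. *)
Lemma hat_borel_hull (A : set X) : hat tau A < +oo ->
  exists G : set B, [/\ measurable G, A `<=` G & hat tau G <= hat tau A].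
Proof.
move=> Aoo; have Afin : hat tau A \is a fin_num.
  by rewrite ge0_fin_numE//; exact: (outer_measure_ge0 mtau).
have /choice[F FP] (n : nat) : exists F : (set X)^nat, A `<=` \bigcup_k F k /\
    \sum_(0 <= k <oo) tau (F k) < hat tau A + n.+1%:R^-1%:E.
  have n0 : (0 < n.+1%:R^-1 :> R)%R by rewrite invr_gt0.
  by have [_ [F AF <-] Fn] := lb_ereal_inf_adherent n0 Afin; exists F.
exists (\bigcap_n \bigcup_k closure (F n k)); split.
- apply: bigcap_measurableType => n _; apply: bigcup_measurable => k _.
  by apply: closed_borel_measurable; exact: closed_closure.
- move=> x Ax n _; have [/(_ x Ax)[k _ Fx] _] := FP n; exists k => //.
  exact: subset_closure.
- apply/lee_addgt0Pr => e e0.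
  have [n /ltW ne] : exists n : nat, (n.+1%:R^-1 < e)%R.
    exists (Num.truncn e^-1); rewrite invf_plt ?posrE//.
    exact: truncnS_gt.
  have [_ /ltW Fn] := FP n.
  apply: (@le_trans _ _ (mtau (\bigcup_k closure (F n k)))).
    by apply: le_outer_measure => x /(_ n I).
  apply: (le_trans (outer_measure_sigma_subadditive mtau _)).
  apply: (@le_trans _ _ (\sum_(0 <= k <oo) tau (F n k))).
    apply: lee_nneseries => [k _ _|k _]; first exact: outer_measure_ge0.
    by apply: le_trans (tau_closure _); exact: (hat_le (premeasure0 tauP) (premeasure_ge0 tauP)).
  by rewrite (le_trans Fn)// leeD2l// lee_fin.
Qed.

Variable f : X -> \bar R.
Hypothesis tau_nu : forall (A : set X) (t : R), (0 < t)%R ->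
  (forall x, A x -> t%:E < f x) -> t%:E * tau A <= nu A.

(** Pieces of a cover cut down to [A] stay in the level set, so [tau_nu] applies to each of them. *)
Let level_le_hat (A : set X) (t : R) : (0 < t)%R ->
  (forall x, A x -> t%:E < f x) -> t%:E * hat tau A <= hat nu A.
Proof.
move=> t0 At; apply: le_ereal_inf_tmp => _ [F AF <-].
have tau_ge0 := premeasure_ge0 tauP; have nu_ge0 := premeasure_ge0 nuP.
apply: (@le_trans _ _ (t%:E * \sum_(0 <= n <oo) tau (A `&` F n))).
  rewrite lee_pmul2l//; apply: ereal_inf_lbound; exists (fun n => A `&` F n) => //.
  by rewrite /= -setI_bigcupr => x Ax; split => //; exact: AF.
rewrite -nneseriesZl//; apply: lee_nneseries => [n _ _|n _].
  by rewrite mule_ge0// lee_fin ltW.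
apply: (@le_trans _ _ (nu (A `&` F n))).
  by apply: tau_nu => // x [/At].
by apply: (le_premeasure nuP); exact: subIsetr.
Qed.

(** The hull has to be good inside every Borel [D]. Split the hull and the level set along [D] by
    Caratheodory's condition; since the mass of the hull outside [D] is finite, it can be
    cancelled. *)
Let level_hull (t : R) : nu setT < +oo -> (0 < t)%R ->
  exists G : set B, [/\ measurable G, [set x | t%:E < f x] `<=` G &
    forall D : set B, measurable D -> t%:E * hat tau (G `&` D) <= hat nu D].
Proof.
move=> nuoo t0; set A := [set x | t%:E < f x].
have Aoo : hat tau A < +oo.
  have : t%:E * hat tau A < +oo.
    rewrite (le_lt_trans (level_le_hat t0 _))//.
    apply: le_lt_trans nuoo.
    apply: (le_trans (hat_le (premeasure0 nuP) (premeasure_ge0 nuP) _)).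
    exact: (le_premeasure nuP).
  by rewrite !ltey; apply: contra_neq => ->; rewrite gt0_muley.
have [G [mG AG GA]] := hat_borel_hull Aoo; exists G; split => // D mD.
apply: (@le_trans _ _ (t%:E * hat tau (A `&` D))); last first.
  apply: (le_trans (level_le_hat t0 _)); first by move=> x [].
  by apply: (le_outer_measure mnu); exact: subIsetr.
rewrite lee_pmul2l//.
have Dc := hat_borel_caratheodory tauP mD.
have GDoo : hat tau (G `&` ~` D) \is a fin_num.
  rewrite ge0_fin_numE; last exact: (outer_measure_ge0 mtau).
  apply: le_lt_trans Aoo; apply: le_trans GA.
  by apply: (le_outer_measure mtau); exact: subIsetl.
rewrite -(leeD2rE _ _ GDoo) -Dc (le_trans GA)// Dc leeD2l//.
by apply: (le_outer_measure mtau); exact: setSI.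
Qed.

Lemma upper_int_pt_le_premeasure : (forall x, 0 <= f x) ->
  upper_int_pt x0 (hat tau) f <= nu setT.
Proof.
move=> f0; have [->|] := eqVneq (nu setT) +oo; first by rewrite leey.
rewrite -ltey => nuoo.
(* An enumeration of the positive rationals; all other codes get the value 1, so that [t n] is
   always positive. *)
pose t n : R := if (choice.unpickle n : option rat) is Some q
  then if (0 < q)%R then ratr q else 1%R else 1%R.
have t0 n : (0 < t n)%R.
  by rewrite /t; case: choice.unpickle => // q; case: ifPn => //; rewrite ltr0q.
have /choice[G GP] n := level_hull nuoo (t0 n).
pose phi := fix phi n : B -> \bar R := if n is m.+1 then
  (fun x => maxe (phi m x) (t m * \1_(G m) x)%:E) else cst 0.
have phi0 n x : 0 <= phi n x.
  by elim: n => //= n ih; rewrite le_max ih.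
have mphi n : measurable_fun setT (phi n).
  elim: n => [|n ih]; first exact: measurable_cst.
  apply: measurable_maxe => //; apply/measurable_EFinP.
  apply: measurable_funM; first exact: measurable_cst.
  by apply: measurable_indic; have [] := GP n.
(* Quantifying over [D] lets the induction split it: on [E] the new term [t n] is the maximum and
   the hull property bounds its integral, and off [E] the maximum is still [phi n]. *)
have intphi n (D : set B) : measurable D -> \int[mu]_(x in D) phi n x <= hat nu D.
  elim: n D => [|n ih] D mD.
    by rewrite integral0; exact: (outer_measure_ge0 mnu).
  have [mG _ hG] := GP n.
  pose E : set B := G n `&` [set x | phi n x < (t n)%:E].
  have mE : measurable E.
    rewrite /E -(setTI [set x | _]); apply: measurableI => //.
    exact: emeasurable_fun_infty_o.
  rewrite -(setUIDK D E) ge0_integral_setU; last 5 first.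
  - exact: measurableI.
  - exact: measurableD.
  - exact: measurable_funTS.
  - by move=> x _; exact: phi0.
  - by apply/disj_setPS => x [[_ Ex] []].
  have -> : \int[mu]_(x in D `&` E) phi n.+1 x = (t n)%:E * mu (D `&` E).
    rewrite -integral_cst; last exact: measurableI.
    apply: eq_integral => x; rewrite inE => -[_ [Gx /= tx]].
    by rewrite indicE mem_set// mulr1; apply/max_idPr/ltW.
  have -> : \int[mu]_(x in D `\` E) phi n.+1 x = \int[mu]_(x in D `\` E) phi n x.
    apply: eq_integral => x; rewrite inE => -[_ /not_andP nE].
    apply/max_idPl; rewrite indicE; case: (boolP (x \in G n)) => [/set_mem Gx|_].
      by rewrite mulr1 leNgt; apply/negP => tx; case: nE.
    by rewrite mulr0.
  rewrite setUIDK (hat_borel_caratheodory nuP mE D) leeD//; last first.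
    exact/ih/measurableD.
  have /hG : measurable (D `&` E) by exact: measurableI.
  by rewrite (_ : G n `&` _ = D `&` E)//; apply/setIidr => x [_ []].
apply: (@le_trans _ _ (upper_int_pt x0 mu (fun x => ereal_sup (range (phi ^~ x))))).
  apply: (@le_upper_int_pt R X x0 mu) => x; rewrite leNgt; apply/negP => lt_f.
  have sup0 : 0 <= ereal_sup (range (phi ^~ x)).
    by apply: le_trans (phi0 0%N x) _; apply: ereal_sup_ubound; exists 0%N.
  (* A rational [q] strictly between is positive, hence is the value of [t] at its own code; [x]
     lies in the hull with that index, and [phi] one step later is at least [q] at [x], a
     contradiction. *)
  have [q /andP[supq qf]] : exists q : rat,
      ereal_sup (range (phi ^~ x)) < (ratr q)%:E < f x.
    move: sup0 lt_f; case: ereal_sup => [s| |]// s0; case: (f x) => [r| |]//.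
      rewrite lte_fin => /rat_in_itvoo[q]; rewrite in_itv/= => sqr.
      by exists q; rewrite !lte_fin.
    move=> _; have /rat_in_itvoo[q] : (s < s + 1)%R by rewrite ltrDl.
    by rewrite in_itv/= => /andP[sq _]; exists q; rewrite lte_fin sq ltry.
  have q0 : (0 < q)%R.
    by have := le_lt_trans sup0 supq; rewrite lte_fin ltr0q.
  have tq : t (choice.pickle q) = ratr q by rewrite /t choice.pickleK q0.
  have [_ fG _] := GP (choice.pickle q).
  move: supq; rewrite ltNge => /negP; apply.
  apply: (@le_trans _ _ (phi (choice.pickle q).+1 x)).
    by rewrite /= le_max indicE mem_set ?mulr1 ?tq ?lexx ?orbT//; apply: fG; rewrite /= tq.
  by apply: ereal_sup_ubound; exists (choice.pickle q).+1.
apply: (@upper_int_pt_monotone_convergence R X x0 mu) => //.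
- by move=> n x /=; rewrite le_max lexx.
- move=> n; apply: (@le_trans _ _ (\int[mu]_x phi n x)).
    by apply: ereal_inf_lbound; exists (phi n).
  apply: (le_trans (intphi n _ measurableT)).
  exact: (hat_le (premeasure0 nuP) (premeasure_ge0 nuP)).
- exact: premeasure_ge0 nuP _.
Qed.

End integral_comparison.

(** * Bounds on extended reals and on sums *)

Section ereal_bounds.
Context {R : realType}.
Local Open Scope ereal_scope.
Implicit Types (A B : set (\bar R)) (c : \bar R).

(** Once [c] is finite, nonemptiness and nonnegativity make every element finite, so subtraction is
    legitimate. *)
Lemma ge0_ereal_supD_le A B c : A !=set0 -> B !=set0 ->
  (forall a, A a -> 0 <= a) -> (forall b, B b -> 0 <= b) ->
  (forall a b, A a -> B b -> a + b <= c) -> ereal_sup A + ereal_sup B <= c.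
Proof.
move=> [a1 Aa1] [b1 Bb1] A0 B0 ABc.
have [->|] := eqVneq c +oo; first by rewrite leey.
rewrite -ltey => coo.
have Afin a : A a -> a \is a fin_num.
  move=> Aa; rewrite ge0_fin_numE ?A0//; apply: le_lt_trans coo.
  by apply: le_trans (ABc a b1 Aa Bb1); rewrite leeDl ?B0.
have supB a : A a -> a + ereal_sup B <= c.
  move=> Aa; rewrite addeC -leeBrDr ?Afin//; apply: ge_ereal_sup => b Bb.
  by rewrite leeBrDr ?Afin// addeC ABc.
have supBfin : ereal_sup B \is a fin_num.
  rewrite ge0_fin_numE; last exact: le_trans (B0 _ Bb1) (ereal_sup_ubound _).
  by apply: le_lt_trans coo; apply: le_trans (supB _ Aa1); rewrite leeDr ?A0.
by rewrite -leeBrDr//; apply: ge_ereal_sup => a Aa; rewrite leeBrDr ?supB.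
Qed.

Lemma ge0_ereal_infD_ge A B c :
  (forall a, A a -> 0 <= a) -> (forall b, B b -> 0 <= b) ->
  (forall a b, A a -> B b -> c <= a + b) -> c <= ereal_inf A + ereal_inf B.
Proof.
move=> A0 B0 ABc.
have iA0 : 0 <= ereal_inf A by exact: le_ereal_inf_tmp.
have iB0 : 0 <= ereal_inf B by exact: le_ereal_inf_tmp.
have [->|] := eqVneq (ereal_inf A) +oo; first by rewrite addye ?leey// -ltNye (lt_le_trans _ iB0).
have [->|] := eqVneq (ereal_inf B) +oo; first by rewrite addey ?leey// -ltNye (lt_le_trans _ iA0).
rewrite -!ltey => iBoo iAoo; apply/lee_addgt0Pr => e e0.
have e2 : (0 < e / 2)%R by rewrite divr_gt0.
have [|a Aa ae] := lb_ereal_inf_adherent e2 (_ : ereal_inf A \is a fin_num).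
  by rewrite ge0_fin_numE.
have [|b Bb be] := lb_ereal_inf_adherent e2 (_ : ereal_inf B \is a fin_num).
  by rewrite ge0_fin_numE.
apply: (le_trans (ABc a b Aa Bb)); apply: (le_trans (leeD (ltW ae) (ltW be))).
by rewrite addeACA -EFinD -splitr.
Qed.

Lemma esumZl (T : choiceType) (S : set T) (a : T -> \bar R) (t : R) :
  (0 < t)%R -> (forall x, S x -> 0 <= a x) ->
  \esum_(x in S) (t%:E * a x) = t%:E * \esum_(x in S) a x.
Proof.
move=> t0 a0; rewrite /esum -ereal_sup_pZl//; congr ereal_sup.
have fsZ F : F `<=` S ->
    \sum_(x \in F) (t%:E * a x) = t%:E * \sum_(x \in F) a x.
  (* [ge0_mule_fsumr] asks for terms nonnegative everywhere, whereas [a] is nonnegative on [S];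
     hence the truncation at 0. *)
  move=> FS; rewrite [in RHS](eq_fsbigr (fun x => maxe (a x) 0)); last first.
    by move=> x /set_mem/FS/a0 ax; apply/esym/max_idPl.
  rewrite ge0_mule_fsumr; last by move=> x; rewrite le_max lexx orbT.
  by apply: eq_fsbigr => x /set_mem/FS/a0 ax; congr (_ * _); apply/esym/max_idPl.
apply/seteqP; split => [_ [F [finF FS] <-]|_ [_ [F [finF FS] <-] <-]] /=.
  by exists (\sum_(x \in F) a x); [exists F|rewrite fsZ].
by exists F => //; rewrite fsZ.
Qed.

Lemma le_ecard_esum (T : choiceType) (F : set T) (c : R) : (0 < c)%R ->
  ecard F * c%:E <= \esum_(x in F) c%:E.
Proof.
move=> c0; have fin_case (G : set T) : finite_set G ->
    (#|` fset_set G|%:R * c)%:E <= \esum_(x in G) c%:E.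
  move=> finG; rewrite esum_fset//; last by move=> *; rewrite lee_fin ltW.
  rewrite fsbig_finite//= sumEFin big_const_seq count_predT iter_addr_0.
  by rewrite mulr_natl lexx.
rewrite /ecard; case: pselect => [finF|infF]; first by rewrite -EFinM fin_case.
(* An infinite [F] has finite subsets of more than [r / c] points, so the sum is at least any real
   [r]. *)
rewrite gt0_mulye ?lte_fin//; rewrite leye_eq; apply/eqP/eq_infty => r.
have [G GF /= Gr] := infinite_set_fset (Num.truncn (r / c)).+1 infF.
apply: (@le_trans _ _ (\esum_(x in [set` G]) c%:E)).
  apply: (le_trans _ (fin_case _ (finite_fset G))); rewrite lee_fin set_fsetK.
  rewrite -ler_pdivrMr// (le_trans (ltW (truncnS_gt _)))// ler_nat.
  exact: Gr.
by apply: ereal_sup_le => _ [H [finH HG] <-]; exists H => //; split => // x /HG/GF.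
Qed.

End ereal_bounds.

(** * Packing premeasures, for a bare symmetric distance so as to cover [maxdist] *)

Section packing_premeasures.
Context {R : realType} {T : choiceType} (d : T -> T -> R).
Hypothesis dxx : forall x, d x x = 0.
Hypothesis d_sym : forall x y, d x y = d y x.
Variable g : R -> R.
Hypothesis g_ge0 : forall r : R, 0 < r -> 0 <= g r.
Local Open Scope ereal_scope.
Implicit Types (A B E : set T) (Delta : set R) (P Q : set (T * R)).

Let sup_gpack Delta delta E :=
  ereal_sup [set gpack g P | P in packing_of d E Delta delta].

Lemma gpack_ge0 Delta delta E P : packing_of d E Delta delta P ->
  0 <= gpack g P.
Proof. by move=> [[P0 _] _ _ _]; apply: esum_ge0 => p /P0/g_ge0; rewrite lee_fin. Qed.

Lemma packing_of_sub Delta delta delta' A B P : A `<=` B ->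
  (delta <= delta')%R -> packing_of d A Delta delta P ->
  packing_of d B Delta delta' P.
Proof.
move=> AB dd' [Ppack PA PD Pd]; split => // p Pp; first exact/AB/PA.
by rewrite (le_trans (Pd _ Pp)).
Qed.

Let le_sup_gpack Delta delta delta' A B : A `<=` B -> (delta <= delta')%R ->
  sup_gpack Delta delta A <= sup_gpack Delta delta' B.
Proof.
move=> AB dd'; apply: ereal_sup_le => _ [P PA <-].
by exists P => //; exact: packing_of_sub PA.
Qed.

Let sup_gpack_ge0 Delta delta E : 0 <= sup_gpack Delta delta E.
Proof.
by apply: ereal_sup_ubound; exists set0 => //; rewrite /gpack esum_set0.
Qed.

Let PDelta0_le Delta delta E : (0 < delta)%R ->
  PDelta0 d g Delta E <= sup_gpack Delta delta E.
Proof.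
move=> delta0; apply: ereal_inf_lbound; exists delta => //.
by rewrite /= in_itv/= delta0.
Qed.

Let le_PDelta0_inf Delta E c :
  (forall delta, (0 < delta)%R -> c <= sup_gpack Delta delta E) ->
  c <= PDelta0 d g Delta E.
Proof.
move=> H; apply: le_ereal_inf_tmp => _ [delta /= + <-].
by rewrite in_itv/= andbT => /H.
Qed.

Lemma PDelta0_set0 Delta : PDelta0 d g Delta set0 = 0.
Proof.
apply/eqP; rewrite eq_le le_PDelta0_inf// andbT.
apply: (le_trans (PDelta0_le _ _ ltr01)); apply: ge_ereal_sup => _ [P [_ P0 _ _] <-].
have -> : P = set0 by apply/seteqP; split => // p /P0.
by rewrite /gpack esum_set0.
Qed.

Lemma PDelta0_ge0 Delta E : 0 <= PDelta0 d g Delta E.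
Proof. exact: le_PDelta0_inf. Qed.

Lemma le_PDelta0 Delta : {homo PDelta0 d g Delta : A B / A `<=` B >-> A <= B}.
Proof.
move=> A B AB; apply: le_PDelta0_inf => delta delta0.
by apply: (le_trans (PDelta0_le _ _ delta0)); exact: le_sup_gpack.
Qed.

Lemma PDelta0_separated Delta A B : positively_separated d A B ->
  PDelta0 d g Delta A + PDelta0 d g Delta B <= PDelta0 d g Delta (A `|` B).
Proof.
move=> [e e0 AB]; apply: le_PDelta0_inf => delta delta0.
(* Radii at most [delta'] are below the separation [e], so a packing of [A] and one of [B] together
   form a packing. *)
pose delta' := (Num.min delta (e / 2))%R.
have delta'0 : (0 < delta')%R by rewrite lt_min delta0 divr_gt0.
have delta'e : (delta' < e)%R.
  by rewrite gt_min; apply/orP; right; rewrite ltr_pdivrMr// ltr_pMr// ltr1n.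
apply: (le_trans (leeD (PDelta0_le _ _ delta'0) (PDelta0_le _ _ delta'0))).
apply: ge0_ereal_supD_le.
- by exists (gpack g (set0 : set (T * R))); exists set0.
- by exists (gpack g (set0 : set (T * R))); exists set0.
- by move=> _ [P PA <-]; exact: gpack_ge0 PA.
- by move=> _ [P PB <-]; exact: gpack_ge0 PB.
move=> _ _ [P PA <-] [Q QB <-].
have [[P0 Psep] PA1 PD Pd] := PA; have [[Q0 Qsep] QB1 QD Qd] := QB.
have PQ0 p q : P p -> Q q -> (e <= d p.1 q.1)%R.
  by move=> /PA1 ? /QB1 ?; exact: AB.
have -> : gpack g P + gpack g Q = gpack g (P `|` Q).
  rewrite /gpack (esumID P (P `|` Q)); last first.
    by move=> p [/P0|/Q0] /g_ge0; rewrite lee_fin.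
  rewrite setUK; congr (_ + esum _ _).
  (* A pair in both packings would have its center at distance at least [e] from itself. *)
  apply/seteqP; split => p; last by move=> [[]].
  move=> Qp; split; first by right.
  by move=> Pp; have := PQ0 _ _ Pp Qp; rewrite dxx leNgt e0.
apply: (@le_trans _ _ (sup_gpack Delta delta' (A `|` B))); last first.
  by apply: le_sup_gpack => //; rewrite ge_min lexx.
apply: ereal_sup_ubound; exists (P `|` Q) => //; split.
- split; first by move=> p [/P0|/Q0].
  move=> p q [Pp|Qp] [Pq|Qq] pq.
  + exact: Psep.
  + by rewrite (le_lt_trans (Pd _ Pp))// (lt_le_trans delta'e)// PQ0.
  + by rewrite (le_lt_trans (Qd _ Qp))// (lt_le_trans delta'e)// d_sym PQ0.
  + exact: Qsep.
- by move=> p [/PA1|/QB1]; [left|right].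
- by move=> p [/PD|/QD].
- by move=> p [/Pd|/Qd].
Qed.

Lemma PDelta0_metric_premeasure Delta : metric_premeasure d (PDelta0 d g Delta).
Proof.
split; [exact: PDelta0_set0|exact: PDelta0_ge0|exact: le_PDelta0|].
exact: PDelta0_separated.
Qed.

(** A packing of the union splits according to whether its centers lie in [A]. This later bounds
    finite unions of members of a cover. *)
Lemma PDelta0_subadditive Delta A B :
  PDelta0 d g Delta (A `|` B) <= PDelta0 d g Delta A + PDelta0 d g Delta B.
Proof.
apply: ge0_ereal_infD_ge => [_ [? _ <-]|_ [? _ <-]|]; [exact: sup_gpack_ge0..|].
move=> _ _ [d1 /= + <-] [d2 /= + <-]; rewrite !in_itv/= !andbT => d10 d20.
pose delta := (Num.min d1 d2)%R.
have delta0 : (0 < delta)%R by rewrite lt_min d10.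
apply: (le_trans (PDelta0_le _ _ delta0)); apply: ge_ereal_sup => _ [P PAB <-].
have [[P0 Psep] PU PD Pd] := PAB.
rewrite /gpack (esumID [set p | A p.1]); last first.
  by move=> p /P0 /g_ge0; rewrite lee_fin.
apply: leeD; apply: ereal_sup_ubound.
  exists (P `&` [set p | A p.1]) => //; split; [split| | |].
  - by move=> p [/P0].
  - by move=> p q [Pp _] [Pq _]; exact: Psep.
  - by move=> p [].
  - by move=> p [/PD].
  - by move=> p [/Pd pd _]; rewrite (le_trans pd)// ge_min lexx.
exists (P `&` ~` [set p | A p.1]) => //; split; [split| | |].
- by move=> p [/P0].
- by move=> p q [Pp _] [Pq _]; exact: Psep.
- by move=> p [/PU[]].
- by move=> p [/PD].
- by move=> p [/Pd pd _]; rewrite (le_trans pd)// ge_min lexx orbT.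
Qed.

Lemma scale_itv : scale (`]0%R, +oo[%classic : set R).
Proof.
split=> // B /(@nbhs_ballP R R^o)[e /= e0 eB].
exists (e / 2)%R; split; first by rewrite /= in_itv/= divr_gt0.
apply: eB; rewrite /ball/= sub0r normrN gtr0_norm ?divr_gt0//.
by rewrite ltr_pdivrMr// ltr_pMr// ltr1n.
Qed.

Lemma lowerP0_metric_premeasure : metric_premeasure d (lowerP0 d g).
Proof.
have ge0 E : 0 <= lowerP0 d g E.
  by apply: le_ereal_inf_tmp => _ [Delta _ <-]; exact: PDelta0_ge0.
have le_P Delta E : scale Delta -> lowerP0 d g E <= PDelta0 d g Delta E.
  by move=> sD; apply: ereal_inf_lbound; exists Delta.
split=> //.
- apply/eqP; rewrite eq_le ge0 andbT.
  by rewrite -(PDelta0_set0 `]0%R, +oo[%classic); exact/le_P/scale_itv.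
- move=> A B AB; apply: le_ereal_inf_tmp => _ [Delta sD <-].
  by apply: (le_trans (le_P _ _ sD)); exact: le_PDelta0.
- move=> A B AB; apply: le_ereal_inf_tmp => _ [Delta sD <-].
  by apply: (le_trans (leeD (le_P _ _ sD) (le_P _ _ sD))); exact: PDelta0_separated.
Qed.

End packing_premeasures.

(** * Packing premeasures and closures *)

Lemma finite_set_lbound_gt0 {R : realType} {T : choiceType} (F : set T)
    (f : T -> R) : finite_set F -> (forall x, F x -> 0 < f x) ->
  exists2 e, 0 < e & forall x, F x -> e <= f x.
Proof.
move=> /finite_seqP[s ->{F}]; elim: s => [|x s ih] f0; first by exists 1.
have [|e e0 se] := ih; first by move=> y /= ys; apply: f0; rewrite /= inE ys orbT.
exists (Num.min e (f x)); first by rewrite lt_min e0 f0//= inE eqxx.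
move=> y; rewrite /= inE => /predU1P[->|ys]; first by rewrite ge_min lexx orbT.
by rewrite ge_min se.
Qed.

Section packing_closure.
Context {R : realType} {X : metricType R} (g : R -> R).
Hypothesis g_ge0 : forall r : R, 0 < r -> 0 <= g r.
Local Open Scope ereal_scope.
Let d := @mdist R X.

(* The packing inequalities are strict and a sum is a supremum of finite sums,
   so the centers of a packing of [closure A] can be moved into [A]. *)
Lemma PDelta0_closure (Delta : set R) (A : set X) :
  PDelta0 d g Delta (closure A) <= PDelta0 d g Delta A.
Proof.
apply: le_ereal_inf_tmp => _ [delta delta0 <-].
apply: ereal_inf_le; eexists; first by exists delta.
apply: ge_ereal_sup => _ [P [[P0 Psep] PA PD Pd] <-].
apply: ge_ereal_sup => _ [F [finF FP] <-].
(* A common slack in the packing inequalities of the finite [F]: moving every center by less than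
   [e / 2] preserves them. *)
have [e e0 eF] : exists2 e : R, (0 < e)%R & forall p q, F p -> F q -> p <> q ->
    (e <= d p.1 q.1 - p.2)%R.
  (* On the diagonal the value 1 keeps the function positive on all of the square of [F]. *)
  have [|pq [Fp Fq]|e e0 eF] := @finite_set_lbound_gt0 R _ (F `*` F)
      (fun pq => if pq.1 == pq.2 then 1%R else (d pq.1.1 pq.2.1 - pq.1.2)%R).
  - exact: finite_setX.
  - by case: eqP => // pq'; rewrite subr_gt0; apply: Psep => //; exact: FP.
  - exists e => // p q Fp Fq pq; have := eF (p, q) (conj Fp Fq).
    by case: eqP.
have /choice[c cP] (p : X * R) : exists x, F p -> A x /\ (d p.1 x < e / 2)%R.
  have [Fp|nFp] := pselect (F p); last by exists p.1.
  have e2 : (0 < e / 2)%R by rewrite divr_gt0.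
  have [x [Ax xe]] := PA _ (FP _ Fp) _ (nbhsx_ballx p.1 _ e2).
  by exists x => _; split => //; rewrite ballEmdist in xe.
pose m p := (c p, p.2).
have csep p q : F p -> F q -> p <> q -> (p.2 < d (c p) (c q))%R.
  move=> Fp Fq pq; have [_ pc] := cP _ Fp; have [_ qc] := cP _ Fq.
  have := eF _ _ Fp Fq pq; have := metric_triangle p.1 (c p) q.1.
  have := metric_triangle (c p) (c q) q.1; rewrite [mdist (c q) _]metric_sym.
  by move: pc qc; rewrite /d; lra.
have m_inj : set_inj F m.
  move=> p q /set_mem Fp /set_mem Fq mpq; apply: contrapT => pq.
  have := csep _ _ Fp Fq pq; case: mpq => -> _.
  by rewrite /d mdistxx ltNge ltW// P0//; exact: FP.
apply: le_trans (ereal_sup_ubound _); last first.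
  exists (m @` F) => //; split.
  - split; first by move=> _ [p /FP/P0 + <-].
    by move=> _ _ [p Fp <-] [q Fq <-] mpq /=; apply: csep => // pq; apply: mpq; rewrite pq.
  - by move=> _ [p /cP[+ _] <-].
  - by move=> _ [p /FP/PD + <-].
  - by move=> _ [p /FP/Pd + <-].
rewrite /gpack esum_image// esum_fset// => p /set_mem/FP/P0/g_ge0.
by rewrite lee_fin.
Qed.

Lemma lowerP0_closure (A : set X) : lowerP0 d g (closure A) <= lowerP0 d g A.
Proof.
apply: le_ereal_inf_tmp => _ [Delta sD <-].
apply: ereal_inf_le; eexists; first by exists Delta.
exact: PDelta0_closure.
Qed.

End packing_closure.

(** * Capacities at small radii *)

Section capacity_below_scale.
Context {R : realType} {T : choiceType} (d : T -> T -> R) (g : R -> R).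
Hypothesis g_gt0 : forall r : R, 0 < r -> 0 < g r.
Local Open Scope ereal_scope.

(** The term of [lowerB0] at a fixed [eps]: a lower bound for it controls all radii below [eps] at
    once, as sufficiently fine packings require. *)
Definition inf_capacity (eps : R) (E : set T) : \bar R :=
  ereal_inf [set Cdelta d delta E * (g delta)%:E | delta in `]0%R, eps[ ].

Lemma Cdelta_ge0 delta E : 0 <= Cdelta d delta E.
Proof.
apply: ereal_sup_ubound; exists set0.
  split => //; rewrite /gap [X in ereal_inf X](_ : _ = set0) ?ereal_inf0 ?ltry//.
  by apply/seteqP; split => // z [xy []].
by rewrite /ecard; case: (pselect _) => [?|/(_ (finite_set0 T))//]; rewrite fset_set0 cardfs0.
Qed.

Lemma le_Cdelta delta : {homo Cdelta d delta : A B / A `<=` B >-> A <= B}.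
Proof.
move=> A B AB; apply: ereal_sup_le => _ [F [FA dF] <-]; exists F => //.
by split => //; exact: subset_trans AB.
Qed.

Lemma inf_capacity_ge0 eps E : 0 <= inf_capacity eps E.
Proof.
apply: le_ereal_inf_tmp => _ [delta /= + <-]; rewrite in_itv/= => /andP[delta0 _].
by rewrite mule_ge0 ?Cdelta_ge0// lee_fin ltW ?g_gt0.
Qed.

Lemma le_inf_capacity (eps eps' : R) A B : (eps' <= eps)%R -> A `<=` B ->
  inf_capacity eps A <= inf_capacity eps' B.
Proof.
move=> ee' AB; apply: le_ereal_inf_tmp => _ [delta /= + <-].
rewrite in_itv/= => /andP[delta0 deltae].
apply: ereal_inf_le; exists (Cdelta d delta A * (g delta)%:E).
  by exists delta => //=; rewrite in_itv/= delta0 (lt_le_trans deltae).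
by apply: lee_wpmul2r; [rewrite lee_fin ltW ?g_gt0|exact: le_Cdelta].
Qed.

(** Makes [lowerB0] the supremum of an increasing sequence, the form that monotone convergence
    takes. *)
Lemma lowerB0E E :
  lowerB0 d g E = ereal_sup (range (fun n : nat => inf_capacity n.+1%:R^-1 E)).
Proof.
apply/eqP; rewrite eq_le; apply/andP; split; apply: ge_ereal_sup.
  move=> _ [eps /= + <-]; rewrite in_itv/= andbT => eps0.
  apply: ereal_sup_ge; exists (inf_capacity (Num.truncn eps^-1).+1%:R^-1 E).
    by exists (Num.truncn eps^-1).
  apply: le_inf_capacity => //; rewrite invf_ple ?posrE//.
  exact/ltW/truncnS_gt.
move=> _ [n _ <-]; apply: ereal_sup_ubound; exists (n.+1%:R^-1)%R => //.
by rewrite /= in_itv/= invr_gt0 ltr0n.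
Qed.

Lemma lowerB0_ge0 E : 0 <= lowerB0 d g E.
Proof.
rewrite lowerB0E; apply: le_trans (inf_capacity_ge0 (1%:R^-1)%R E) _.
by apply: ereal_sup_ubound; exists 0%N.
Qed.

Lemma le_lowerB0 : {homo lowerB0 d g : A B / A `<=` B >-> A <= B}.
Proof.
move=> A B AB; rewrite !lowerB0E; apply: ge_ereal_sup => _ [n _ <-].
apply: ereal_sup_ge; exists (inf_capacity n.+1%:R^-1 B); first by exists n.
exact: le_inf_capacity.
Qed.

End capacity_below_scale.

(** * Packings of a product built from packings and sections *)

Section maxdist.
Context {R : realType} {X Y : metricType R}.
Implicit Types p q : X * Y.

Lemma maxdistxx p : maxdist p p = 0.
Proof. by rewrite /maxdist !mdistxx maxxx. Qed.

Lemma maxdist_sym p q : maxdist p q = maxdist q p.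
Proof. by rewrite /maxdist metric_sym [mdist p.2 _]metric_sym. Qed.

End maxdist.

Section sections.
Context {R : realType} {X Y : metricType R} (g h : R -> R).
Hypotheses (hg : hausdorff_fun g) (hh : hausdorff_fun h).
Local Open Scope ereal_scope.
Let dX := @mdist R X.
Let dY := @mdist R Y.
Let dXY := @maxdist R X Y.
Let gh r := (g r * h r)%R.
Implicit Types (E : set (X * Y)) (A : set X) (Delta : set R).

Let g_gt0 (r : R) : (0 < r)%R -> (0 < g r)%R. Proof. by case: hg => + _; apply. Qed.
Let h_gt0 (r : R) : (0 < r)%R -> (0 < h r)%R. Proof. by case: hh => + _; apply. Qed.
Let h_ge0 (r : R) : (0 < r)%R -> (0 <= h r)%R. Proof. by move=> /h_gt0/ltW. Qed.
Let gh_ge0 (r : R) : (0 < r)%R -> (0 <= gh r)%R.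
Proof. by move=> r0; rewrite mulr_ge0// ltW ?g_gt0 ?h_gt0. Qed.

(** New points over different pairs of the packing are separated in [X], those over the same pair in
    [Y]. Each pair (x, r) contributes at least [t * h r], its fiber having enough points. *)
Lemma PDelta0_sections Delta E A (t eps : R) : (0 < t)%R -> (0 < eps)%R ->
  (forall x, A x -> t%:E < inf_capacity dY g eps (xsection E x)) ->
  t%:E * PDelta0 dX h Delta A <= PDelta0 dXY gh Delta (E `&` A `*` setT).
Proof.
move=> t0 eps0 At; apply: le_ereal_inf_tmp => _ [delta0 /= + <-].
rewrite in_itv/= andbT => delta0_gt0.
(* Radii may equal [delta], while [inf_capacity] takes radii strictly below [eps]; hence the
   half. *)
pose delta := (Num.min delta0 (eps / 2))%R.
have delta_gt0 : (0 < delta)%R by rewrite lt_min delta0_gt0 divr_gt0.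
have delta_eps : (delta < eps)%R.
  by rewrite gt_min; apply/orP; right; rewrite ltr_pdivrMr// ltr_pMr// ltr1n.
set S := ereal_sup _.
apply: (@le_trans _ _
    (t%:E * ereal_sup [set gpack h P | P in packing_of dX A Delta delta])).
  rewrite lee_pmul2l//; apply: ereal_inf_lbound; exists delta => //.
  by rewrite /= in_itv/= delta_gt0.
rewrite -ereal_sup_pZl//.
apply: ge_ereal_sup => _ [_ [P [[P0 Psep] PA PD Pd] <-] <-].
have /choice[F FP] (p : X * R) : exists F : set Y, P p ->
    [/\ F `<=` xsection E p.1, (p.2)%:E < gap dY F &
        t%:E < ecard F * (g p.2)%:E].
  have [Pp|nPp] := pselect (P p); last by exists set0.
  have p0 := P0 _ Pp.
  have : t%:E < Cdelta dY p.2 (xsection E p.1) * (g p.2)%:E.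
    apply: (lt_le_trans (At _ (PA _ Pp))); apply: ereal_inf_lbound.
    by exists p.2 => //=; rewrite in_itv/= p0 (le_lt_trans (Pd _ Pp)).
  rewrite -lte_pdivrMr ?g_gt0// => /ereal_sup_gt[_ [F [FE pF] <-]].
  by rewrite lte_pdivrMr ?g_gt0// => tF; exists F.
pose m (k : X * R * Y) := ((k.1.1, k.2), k.1.2).
have m_inj K : set_inj K m by move=> [[x r] y] [[x' r'] y'] _ _ [-> -> ->].
pose Q := m @` (P `*`` F).
have QP : packing_of dXY (E `&` A `*` setT) Delta delta0 Q.
  split.
  - split; first by move=> _ [k [/P0 + _] <-].
    move=> _ _ [[p y] [/= Pp Fy] <-] [[q z] [/= Pq Fz] <-] kk'.
    rewrite /m/= /dXY /maxdist/= lt_max.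
    have [pq|/eqP pq] := eqVneq p q; last by rewrite Psep.
    apply/orP; right; rewrite -lte_fin; subst q.
    have [_ pF _] := FP _ Pp; apply: (lt_le_trans pF).
    apply: ereal_inf_lbound; exists (y, z) => //; split => //= yz.
    by apply: kk'; rewrite yz.
  - move=> _ [[p y] [/= Pp Fy] <-]; have [/(_ _ Fy) + _ _] := FP _ Pp.
    by rewrite /xsection/= inE => Ey; split => //; split => //; exact: PA.
  - by move=> _ [k [/PD + _] <-].
  - move=> _ [k [/Pd kd _] <-]; rewrite (le_trans kd)//.
    by rewrite ge_min lexx.
apply: (@le_trans _ _ (gpack gh Q)); last by apply: ereal_sup_ubound; exists Q.
rewrite /gpack /Q esum_image//.
rewrite -(esum_esum (a := fun p _ => (gh p.2)%:E)); last first.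
  by move=> p y Pp _; rewrite lee_fin gh_ge0 ?P0.
rewrite -esumZl//; last by move=> p Pp; rewrite lee_fin h_ge0 ?P0.
apply: le_esum => p Pp; have p0 := P0 _ Pp; have [_ _ tF] := FP _ Pp.
apply: le_trans (le_ecard_esum _ _); last by rewrite mulr_gt0 ?g_gt0 ?h_gt0.
by rewrite EFinM muleA lee_wpmul2r ?lee_fin ?h_ge0// ltW.
Qed.

(** Cylinders over separated sets are separated for [maxdist]. This set function is the [nu] of the
    integral comparison. *)
Lemma sections_metric_premeasure Delta E :
  metric_premeasure dX (fun A => PDelta0 dXY gh Delta (E `&` A `*` setT)).
Proof.
have PP := PDelta0_metric_premeasure (@maxdistxx R X Y) (@maxdist_sym R X Y)
  gh_ge0 Delta.
split.
- by rewrite set0X setI0 (premeasure0 PP).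
- by move=> A; exact: (premeasure_ge0 PP).
- move=> A B AB; apply: (le_premeasure PP).
  by apply: setIS; exact: setSX.
- move=> A B [e e0 AB]; rewrite !setXT preimage_setU setIUr.
  apply: (premeasure_separated PP).
  exists e => // -[a y] [b z] [_ /= Aa] [_ /= Bb].
  by rewrite /maxdist le_max AB.
Qed.

Variable x0 : X.

(** Asking only that [tau] be at most [PDelta0] covers both [upperP0] and [lowerP0]; the latter is
    below [PDelta0] at every scale, so the infimum over [Delta] can be taken afterwards. *)
Lemma upper_int_lowerB0 Delta E (tau : set X -> \bar R) :
  metric_premeasure dX tau -> (forall A, tau (closure A) <= tau A) ->
  (forall A, tau A <= PDelta0 dX h Delta A) ->
  upper_int_pt x0 (hat tau) (fun x => lowerB0 dY g (xsection E x)) <=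
  PDelta0 dXY gh Delta E.
Proof.
move=> tauP tau_closure tau_le; have nuP := sections_metric_premeasure Delta E.
under eq_fun do rewrite lowerB0E//.
apply: (@upper_int_pt_monotone_convergence R X x0 (hat_borel x0 tauP)).
- by move=> n x; exact: inf_capacity_ge0.
- move=> n x; apply: le_inf_capacity => //.
  by rewrite lef_pV2 ?posrE// ler_nat.
- move=> n; have n0 : (0 < n.+1%:R^-1 :> R)%R by rewrite invr_gt0.
  have := @upper_int_pt_le_premeasure R X x0 tau _ tauP tau_closure nuP
    (fun x => inf_capacity dY g n.+1%:R^-1 (xsection E x)).
  rewrite setXTT setIT; apply; last by move=> x; exact: inf_capacity_ge0.
  move=> A t t0 At; apply: le_trans (PDelta0_sections _ t0 n0 At).
  by rewrite lee_pmul2l.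
- by have := premeasure_ge0 nuP setT; rewrite setXTT setIT.
Qed.

Lemma upperP0_metric_premeasure : metric_premeasure dX (upperP0 dX h).
Proof.
by apply: PDelta0_metric_premeasure => //; [exact: mdistxx|exact: metric_sym].
Qed.

Lemma lowerP0_mdist_premeasure : metric_premeasure dX (lowerP0 dX h).
Proof.
by apply: lowerP0_metric_premeasure => //; [exact: mdistxx|exact: metric_sym].
Qed.

Lemma upper_int_lowerB0_upperP E :
  upper_int_pt x0 (upperP dX h) (fun x => lowerB0 dY g (xsection E x)) <=
  upperP0 dXY gh E.
Proof.
apply: upper_int_lowerB0 => //; first exact: upperP0_metric_premeasure.
by move=> A; exact: PDelta0_closure.
Qed.

Lemma upper_int_lowerB0_lowerP E :
  upper_int_pt x0 (lowerP dX h) (fun x => lowerB0 dY g (xsection E x)) <=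
  lowerP0 dXY gh E.
Proof.
apply: le_ereal_inf_tmp => _ [Delta sD <-]; apply: upper_int_lowerB0 => [|A|A].
- exact: lowerP0_mdist_premeasure.
- exact: lowerP0_closure.
- by apply: ereal_inf_lbound; exists Delta.
Qed.

End sections.

(** * Increasing sequences of sets and their sections *)

Lemma arrow_ge0 {R : realType} {T : Type} (tau : set T -> \bar R) (E : set T) :
  (forall A, (0 <= tau A)%E) -> (0 <= arrow tau E)%E.
Proof.
move=> tau_ge0; apply: le_ereal_inf_tmp => _ [F _ <-].
by apply: le_trans (tau_ge0 (F 0%N)) _; apply: ereal_sup_ubound; exists 0%N.
Qed.

Lemma xsection_increasing {X Y : Type} (S : (set (X * Y))^nat) (x : X) :
  (forall n, S n `<=` S n.+1) ->
  forall n, xsection (S n) x `<=` xsection (S n.+1) x.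
Proof. by move=> Snd n; exact: le_xsection. Qed.

Section upper_integral_arrow.
Context {R : realType} {X Y : metricType R} (g : R -> R).
Hypothesis g_gt0 : forall r : R, 0 < r -> 0 < g r.
Local Open Scope ereal_scope.
Let dX := @mdist R X.
Let dY := @mdist R Y.
Variables (S : (set (X * Y))^nat) (E : set (X * Y)).
Hypotheses (Snd : forall n, S n `<=` S n.+1) (SE : \bigcup_n S n = E).

Lemma vecB_le_sup_lowerB0 x : vecB dY g (xsection E x) <=
  ereal_sup (range (fun n => lowerB0 dY g (xsection (S n) x))).
Proof.
apply: ereal_inf_lbound; exists (fun n => xsection (S n) x) => //; split.
  exact: xsection_increasing.
by rewrite -xsection_bigcup SE.
Qed.

(** The sections of [S n] increase to those of [E], so a bound valid at every stage passes to [vecB]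
    by monotone convergence. *)
Lemma upper_int_vecB (x0 : X) (tau : set X -> \bar R) (c : \bar R) :
  metric_premeasure dX tau -> 0 <= c ->
  (forall n, upper_int_pt x0 (hat tau)
               (fun x => lowerB0 dY g (xsection (S n) x)) <= c) ->
  upper_int_pt x0 (hat tau) (fun x => vecB dY g (xsection E x)) <= c.
Proof.
move=> tauP c0 Sc.
apply: (le_trans (@le_upper_int_pt R X x0 (hat_borel x0 tauP) _ _
  vecB_le_sup_lowerB0)).
apply: (@upper_int_pt_monotone_convergence R X x0 (hat_borel x0 tauP)) => //.
- by move=> n x; exact: lowerB0_ge0.
- by move=> n x; apply: le_lowerB0 => //; exact: xsection_increasing.
Qed.

End upper_integral_arrow.

(** Serves the last inequality, where the infimum may be infinite and only finite [s] below it can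
    be fed to [PDelta0_sections]. *)
Lemma lee_mul_lt {R : realType} (c v M : \bar R) : (0 <= c)%E -> (0 <= v)%E ->
  (0 <= M)%E -> (forall s : R, 0 < s -> (s%:E < c)%E -> (s%:E * v <= M)%E) ->
  (c * v <= M)%E.
Proof.
move=> c0 v0 M0 H.
have [->|vN0] := eqVneq v 0%E; first by rewrite mule0.
have [->|cN0] := eqVneq c 0%E; first by rewrite mul0e.
have {}v0 : (0 < v)%E by rewrite lt0e vN0.
have {}c0 : (0 < c)%E by rewrite lt0e cN0.
case: c c0 {cN0} H => [c| |]// c0 H.
  apply/lee_mul01Pr; first by rewrite mule_ge0// ltW.
  move=> r /andP[r0 r1]; rewrite muleA -EFinM; apply: H.
    by rewrite mulr_gt0.
  by rewrite lte_fin gtr_pMl.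
rewrite gt0_mulye//; case: v v0 {vN0} H => [v| |]// v0 H.
  rewrite leye_eq; apply/eqP/eqyP => r r0.
  (* With [c] infinite every positive [s] is allowed, and this one forces [M] to be at least [r]. *)
  have := H (r / v) (divr_gt0 r0 v0) (ltry _).
  by rewrite -EFinM divfK// gt_eqF.
by have := H 1 ltr01 (ltry _); rewrite mul1e.
Qed.

(** * The four product inequalities *)

Section product_inequalities.
Context {R : realType} {X Y : metricType R} (g h : R -> R).
Hypotheses (hg : hausdorff_fun g) (hh : hausdorff_fun h).
Local Open Scope ereal_scope.
Let dX := @mdist R X.
Let dY := @mdist R Y.
Let dXY := @maxdist R X Y.
Let gh r := (g r * h r)%R.
Variable E : set (X * Y).

Let g_gt0 (r : R) : (0 < r)%R -> (0 < g r)%R. Proof. by case: hg => + _; apply. Qed.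
Let gh_ge0 (r : R) : (0 < r)%R -> (0 <= gh r)%R.
Proof. by move=> r0; case: hg hh => g0 _ [h0 _]; rewrite mulr_ge0// ltW ?g0 ?h0. Qed.

Let upperP0_ge0 A : 0 <= upperP0 dXY gh A.
Proof. exact: PDelta0_ge0. Qed.

Let lowerP0_ge0 A : 0 <= lowerP0 dXY gh A.
Proof.
by apply: le_ereal_inf_tmp => _ [Delta _ <-]; exact: PDelta0_ge0.
Qed.

(** The partial unions of a cover, cut down to [E], increase to [E]; finite subadditivity of
    [upperP0] bounds each stage by a partial sum of the series. *)
Lemma upper_int_vecB_upperP :
  upper_int (upperP dX h) (fun x => vecB dY g (xsection E x)) <=
  upperP dXY gh E.
Proof.
(* For empty [X] the value of [upper_int] is 0, and nonnegativity of the right side is what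
   remains. *)
rewrite /upper_int; case: (pselectT X) => [_|x0]; first exact: hat_ge0.
apply: le_ereal_inf_tmp => _ [F EF <-].
pose S n := E `&` \big[setU/set0]_(k < n.+1) F k.
have Snd n : S n `<=` S n.+1.
  by apply: setIS; rewrite [X in _ `<=` X]big_ord_recr/=; exact: subsetUl.
have SE : \bigcup_n S n = E.
  apply/seteqP; split => [p [n _ []]//|p Ep]; have [n _ Fp] := EF _ Ep.
  by exists n => //; split => //; rewrite big_ord_recr/=; right.
have upperP0_sub n : upperP0 dXY gh (\big[setU/set0]_(k < n) F k) <=
    \sum_(0 <= k < n) upperP0 dXY gh (F k).
  elim: n => [|n ih]; first by rewrite big_ord0 big_geq// /upperP0 PDelta0_set0.
  rewrite big_ord_recr big_nat_recr//=.
  by apply: (le_trans (PDelta0_subadditive _ _ _ _ _)) => //; rewrite leeD2r.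
apply: (upper_int_vecB g_gt0 Snd SE); first exact: upperP0_metric_premeasure.
  exact: nneseries_ge0.
move=> n; apply: (le_trans (upper_int_lowerB0_upperP hg hh x0 _)).
apply: (@le_trans _ _ (upperP0 dXY gh (\big[setU/set0]_(k < n.+1) F k))).
  by apply: le_PDelta0; exact: subIsetr.
by apply: (le_trans (upperP0_sub _)); exact: nneseries_lim_ge.
Qed.

(** The sections of the members of a cover of [E] cover the sections of [E], so countable
    subadditivity of the upper integral suffices. *)
Lemma upper_int_lowerB_lowerP :
  upper_int (lowerP dX h) (fun x => lowerB dY g (xsection E x)) <=
  lowerP dXY gh E.
Proof.
rewrite /upper_int; case: (pselectT X) => [_|x0]; first exact: hat_ge0.
apply: le_ereal_inf_tmp => _ [F EF <-].
apply: (@upper_int_pt_sigma_subadditive R X x0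
  (hat_borel x0 (lowerP0_mdist_premeasure hh)) _
  (fun n x => lowerB0 dY g (xsection (F n) x))) => //.
- by move=> n x; exact: lowerB0_ge0.
- move=> x; apply: ereal_inf_lbound; exists (fun n => xsection (F n) x) => //=.
  by rewrite -xsection_bigcup; exact: le_xsection.
- by move=> n; exact: upper_int_lowerB0_lowerP.
Qed.

Lemma upper_int_vecB_vecP :
  upper_int (lowerP dX h) (fun x => vecB dY g (xsection E x)) <=
  vecP dXY gh E.
Proof.
rewrite /upper_int; case: (pselectT X) => [_|x0]; first exact: arrow_ge0.
apply: le_ereal_inf_tmp => _ [S [Snd SE] <-].
have le_sup n : lowerP0 dXY gh (S n) <=
    ereal_sup (range (fun n => lowerP0 dXY gh (S n))).
  by apply: ereal_sup_ubound; exists n.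
apply: (upper_int_vecB g_gt0 Snd SE); first exact: lowerP0_mdist_premeasure.
  exact: le_trans (le_sup 0%N).
by move=> n; apply: le_trans (le_sup n); exact: upper_int_lowerB0_lowerP.
Qed.

(** For [s] below the infimum, the points whose section of [S n] has capacity above [s] at small
    radii form sets increasing to [X]; [PDelta0_sections] applies on each of them. *)
Lemma inf_vecB_mul_vecP :
  ereal_inf [set vecB dY g (xsection E x) | x in [set: X]] *
    vecP dX h [set: X] <= vecP dXY gh E.
Proof.
have hP := lowerP0_mdist_premeasure (X := X) hh.
apply: lee_mul_lt.
- apply: le_ereal_inf_tmp => _ [x _ <-]; apply: arrow_ge0 => A.
  exact: lowerB0_ge0.
- by apply: arrow_ge0 => A; exact: (premeasure_ge0 hP).
- exact: arrow_ge0.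
move=> s s0 sinf; apply: le_ereal_inf_tmp => _ [S [Snd SE] <-].
(* One index governs both the set [S n] and the range of radii, so that [A] increases; a point found
   with two different indices is in [A] at their maximum. *)
pose A n := [set x : X | s%:E < inf_capacity dY g n.+1%:R^-1 (xsection (S n) x)].
have Anm n m k x : (n <= k)%N -> (m <= k)%N ->
    s%:E < inf_capacity dY g m.+1%:R^-1 (xsection (S n) x) -> A k x.
  move=> nk mk /lt_le_trans; apply; apply: le_inf_capacity => //.
    by rewrite lef_pV2 ?posrE// ler_nat.
  apply: le_xsection; move: nk => /subnK <-.
  by elim: (k - n)%N => // i ih; rewrite addSn; exact: subset_trans (Snd _).
have AT : \bigcup_n A n = [set: X].
  apply/seteqP; split => // x _.
  have : s%:E < vecB dY g (xsection E x).
    by apply: (lt_le_trans sinf); apply: ereal_inf_lbound; exists x.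
  move=> /lt_le_trans/(_ (vecB_le_sup_lowerB0 g Snd SE x)).
  move=> /ereal_sup_gt[_ [n _ <-]]; rewrite lowerB0E//.
  move=> /ereal_sup_gt[_ [m _ <-]] sx; exists (maxn n m) => //.
  by apply: Anm sx; [exact: leq_maxl|exact: leq_maxr].
apply: (@le_trans _ _ (s%:E * ereal_sup (range (fun n => lowerP0 dX h (A n))))).
  rewrite lee_pmul2l//; apply: ereal_inf_lbound; exists A => //; split => // n x.
  by apply: Anm.
rewrite -ereal_sup_pZl//; apply: ge_ereal_sup => _ [_ [n _ <-] <-].
apply: (@le_trans _ _ (lowerP0 dXY gh (S n))); last first.
  by apply: ereal_sup_ubound; exists n.
apply: le_ereal_inf_tmp => _ [Delta sD <-].
have n0 : (0 < n.+1%:R^-1 :> R)%R by rewrite invr_gt0.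
apply: (@le_trans _ _ (PDelta0 dXY gh Delta (S n `&` A n `*` setT))).
  apply: le_trans (PDelta0_sections hg hh _ s0 n0 _) => //.
  by rewrite lee_pmul2l//; apply: ereal_inf_lbound; exists Delta.
by apply: le_PDelta0; exact: subIsetl.
Qed.

End product_inequalities.

Unset Implicit Arguments.

Theorem theorem3p5 (R : realType) (X Y : metricType R) (g h : R -> R)
  (hg : hausdorff_fun g) (hh : hausdorff_fun h) (E : set (X * Y)) :
  let dX := @mdist R X in
  let dY := @mdist R Y in
  let dXY := @maxdist R X Y in
  let gh := fun r => g r * h r in
  [/\ (upper_int (upperP dX h) (fun x => vecB dY g (xsection E x))
         <= upperP dXY gh E)%E,
      (upper_int (lowerP dX h) (fun x => lowerB dY g (xsection E x))
         <= lowerP dXY gh E)%E,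
      (upper_int (lowerP dX h) (fun x => vecB dY g (xsection E x))
         <= vecP dXY gh E)%E
    & (ereal_inf [set vecB dY g (xsection E x) | x in [set: X]] * vecP dX h [set: X]
         <= vecP dXY gh E)%E].
Proof.
split; [exact: upper_int_vecB_upperP|exact: upper_int_lowerB_lowerP|
  exact: upper_int_vecB_vecP|exact: inf_vecB_mul_vecP].
Qed.
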